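(* Let $E$ be a Banach space, let $X$ be a closed subspace of $E$ and let $Z$ be a closed subspace of $E^*$. If $X$ is reflexive, then the following conditions are equivalent: (1) $X$ is norming for $Z$ and $Z$ is total over $X$. (2) $Z$ is norming for $X$ and $X$ is total over $Z$. (3) $X$ is norming for $Z$ and $Z$ is norming for $X$. (4) $Z$ is $w^*$-closed and $E = X\oplus Z_{\perp}$.
   Context: $E^*$ is the dual of the Banach space $E$, and $w^*$ denotes the weak-star topology $\sigma(E^*,E)$ on $E^*$. $B_Y$ denotes the unit ball of a normed space $Y$. For a subspace $X\subset E$ and a subspace $Z\subset E^*$: - $Z_{\perp} = \{x\in E : f(x)=0 \text{ for every } f\in Z\}$ and $X^{\perp} = \{f\in E^* : f(x)=0 \text{ for every } x\in X\}$. - $Z$ is norming for $X$ if the formula $|||x||| = \sup_{f\in B_Z}|f(x)|$, $x\in X$, defines an equivalent norm on $X$. - $X$ is norming for $Z$ if the image of $X$ under the canonical map $\pi: E\to E^{**}$ is norming for $Z$, i.e. the formula $|||f||| = \sup_{x\in B_X}|f(x)|$, $f\in Z$, defines an equivalent norm on $Z$. - $Z$ is total over $X$ if $X\cap Z_{\perp}=\{0\}$. - $X$ is total over $Z$ if $X^{\perp}\cap Z=\{0\}$. $E = X\oplus Z_{\perp}$ means that $X\cap Z_{\perp}=\{0\}$ and $X+Z_{\perp}=E$. *)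

(* Defs.v *)
From HB Require Import structures.
From mathcomp Require Import all_boot all_order all_algebra.
From mathcomp Require Import all_classical all_reals all_analysis.
From mathcomp Require Import complex.

Set Implicit Arguments.
Unset Strict Implicit.
Unset Printing Implicit Defensive.

Import Order.TTheory GRing.Theory Num.Theory.
Import numFieldNormedType.Exports.

Local Open Scope classical_set_scope.
Local Open Scope ring_scope.

(* Banach spaces over R and over C are treated at once: [scalars R k] is R or
   R[i], as a numFieldType. *)
Variant scalar_kind := RealScalars | ComplexScalars.

Definition scalars (R : realType) (k : scalar_kind) : numFieldType :=
  match k with
  | RealScalars => R
  | ComplexScalars => R[i]
  end.

Definition real_part (R : realType) (k : scalar_kind) : scalars R k -> R :=
  match k return scalars R k -> R with
  | RealScalars => fun x => x
  | ComplexScalars => fun z => complex.Re z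
  end.

Definition of_real (R : realType) (k : scalar_kind) : R -> scalars R k :=
  match k return R -> scalars R k with
  | RealScalars => fun x => x
  | ComplexScalars => fun x => Complex x 0
  end.

Section scalars_theory.
Context {R : realType} {k : scalar_kind}.
Local Notation K := (scalars R k).
Implicit Types (x y : K) (a b : R).

Lemma real_partD x y : real_part (x + y) = real_part x + real_part y.
Proof. by case: k x y => //= -[a b] [c d]. Qed.

Lemma of_realD a b : of_real k (a + b) = of_real k a + of_real k b.
Proof. by case: k => //=; apply/eqP; rewrite eq_complex /= addr0 !eqxx. Qed.

Lemma of_realM a b : of_real k (a * b) = of_real k a * of_real k b.
Proof.
case: k => //=; apply/eqP.
by rewrite eq_complex /= !(mul0r, mulr0) subr0 addr0 !eqxx.
Qed.

Lemma of_realK a : real_part (of_real k a) = a.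
Proof. by case: k. Qed.

Lemma of_real0 : of_real k (0 : R) = 0.
Proof. by case: k. Qed.

Lemma ler_of_real a b : (of_real k a <= of_real k b) = (a <= b).
Proof. by case: k => //; rewrite lecE /= eqxx. Qed.

Lemma real_partK x : 0 <= x -> of_real k (real_part x) = x.
Proof.
by case: k x => //= -[a b]; rewrite lecE /= => /andP[/eqP -> _].
Qed.

Lemma ler_real_part x y : x <= y -> real_part x <= real_part y.
Proof. by case: k x y => //= -[a b] [c d]; rewrite lecE => /andP[]. Qed.

End scalars_theory.

(* The norm of a normed module over K takes its values in K (in the
   nonnegative reals of K); [rnorm] is the same norm with values in R. *)
Definition rnorm (R : realType) (k : scalar_kind)
    (V : normedModType (scalars R k)) (x : V) : R := real_part `|x|.

Definition unit_ball (R : realType) (k : scalar_kind)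
    (V : normedModType (scalars R k)) : set V := [set x | rnorm x <= 1].
Arguments unit_ball {R k} V.

Section rnorm_theory.
Context {R : realType} {k : scalar_kind} {V : normedModType (scalars R k)}.
Implicit Types x y : V.

Lemma rnormE x : of_real k (rnorm x) = `|x|.
Proof. by rewrite real_partK. Qed.

Lemma rnorm_ge0 x : 0 <= rnorm x.
Proof. by rewrite -(ler_of_real (k := k)) of_real0 rnormE. Qed.

Lemma rnorm0 : rnorm (0 : V) = 0.
Proof. by rewrite /rnorm normr0 -of_real0 of_realK. Qed.

Lemma rnorm0_eq0 x : rnorm x = 0 -> x = 0.
Proof. by move=> x0; apply/normr0_eq0; rewrite -rnormE x0 of_real0. Qed.

Lemma ler_rnormD x y : rnorm (x + y) <= rnorm x + rnorm y.
Proof. by rewrite -real_partD ler_real_part// ler_normD. Qed.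

Lemma rnormZ (a : scalars R k) x :
  rnorm (a *: x) = real_part `|a| * rnorm x.
Proof.
rewrite {1}/rnorm normrZ -[`|x|]rnormE -[`|a|]real_partK//.
by rewrite -of_realM !of_realK.
Qed.

End rnorm_theory.

Section continuous_dual.
Context {R : realType} {k : scalar_kind} (V : normedModType (scalars R k)).
Local Notation K := (scalars R k).

Definition dual_pred : {pred V -> K^o} :=
  [pred f : V -> K^o | `[< scalar f /\ continuous f >]].

Lemma dual_pred_submod_closed : submod_closed dual_pred.
Proof.
split=> [|a f g].
  apply/asboolP; split=> [b x y|]; first by rewrite mulr0 addr0.
  exact: cst_continuous.
move=> /asboolP[lf cf] /asboolP[lg cg]; apply/asboolP; split.
  move=> b x y.
  rewrite -[LHS]/(a * f (b *: x + y) + g (b *: x + y)) lf lg.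
  rewrite -[RHS]/(b * (a * f x + g x) + (a * f y + g y)).
  by rewrite !mulrDr addrACA mulrCA.
move=> x; apply: cvgD; last exact: cg.
by apply: cvgZr; exact: cf.
Qed.

HB.instance Definition _ := GRing.isSubmodClosed.Build K (V -> K^o)
  dual_pred dual_pred_submod_closed.

Record dual := Dual { dual_fun :> V -> K^o; _ : dual_fun \in dual_pred }.

HB.instance Definition _ := [isSub for dual_fun].
HB.instance Definition _ := [Choice of dual by <:].
HB.instance Definition _ := [SubChoice_isSubLmodule of dual by <:].

Implicit Types f : dual.

Lemma dual_linear f : scalar f.
Proof. by case: f => f /= /asboolP[]. Qed.

Lemma dual_continuous f : continuous (f : V -> K^o).
Proof. by case: f => f /= /asboolP[]. Qed.

HB.instance Definition _ f :=
  GRing.isLinear.Build K V K^o *:%R (f : V -> K^o) (dual_linear f).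

Definition dual_norm f : R := sup [set rnorm (f x) | x in unit_ball V].

Lemma dual_bounded f : exists M : R, forall x, rnorm (f x) <= M * rnorm x.
Proof.
have /linear_bounded_continuous/linear_boundedP := @dual_continuous f.
move=> /pinfty_ex_gt0[M M0 Mf]; exists (real_part M) => x.
have -> : real_part M * rnorm x = real_part (M * `|x|).
  by rewrite -[in RHS](real_partK (ltW M0)) -rnormE -of_realM of_realK.
exact: ler_real_part (Mf x).
Qed.

Lemma dual_norm_has_sup f : has_sup [set rnorm (f x) | x in unit_ball V].
Proof.
split; first by exists (rnorm (f 0)), 0 => //; rewrite /unit_ball/= rnorm0.
have [M Mf] := dual_bounded f; exists `|M| => _ [x x1 <-].
rewrite (le_trans (Mf x))// (le_trans (ler_norm _))// normrM.
by rewrite ler_piMr// (ger0_norm (rnorm_ge0 _)).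
Qed.

Lemma dual_norm_ub f x : rnorm x <= 1 -> rnorm (f x) <= dual_norm f.
Proof.
by move=> x1; apply: ub_le_sup; [case: (dual_norm_has_sup f)|exists x].
Qed.

Lemma dual_norm_le f (M : R) :
  (forall x, rnorm x <= 1 -> rnorm (f x) <= M) -> dual_norm f <= M.
Proof.
move=> fM; apply: ge_sup; first by case: (dual_norm_has_sup f).
by move=> _ [x x1 <-]; exact: fM.
Qed.

Lemma dual_norm_ge0 f : 0 <= dual_norm f.
Proof. by rewrite (le_trans _ (@dual_norm_ub f 0 _)) ?rnorm_ge0 ?rnorm0. Qed.

Lemma ler_dual_normD f g : dual_norm (f + g) <= dual_norm f + dual_norm g.
Proof.
apply: dual_norm_le => x x1; rewrite (le_trans (ler_rnormD _ _))//.
by rewrite lerD// dual_norm_ub.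
Qed.

Lemma dual_norm0 : dual_norm 0 = 0.
Proof.
apply/eqP; rewrite eq_le dual_norm_ge0 andbT.
by apply: dual_norm_le => x _; rewrite rnorm0.
Qed.

Lemma dual_normZ (a : K) f : dual_norm (a *: f) = real_part `|a| * dual_norm f.
Proof.
have le_normZ b g : dual_norm (b *: g) <= real_part `|b| * dual_norm g.
  apply: dual_norm_le => x x1; rewrite rnormZ.
  by rewrite ler_wpM2l ?dual_norm_ub// (rnorm_ge0 (b : K^o)).
have [->|a0] := eqVneq a 0.
  by rewrite scale0r dual_norm0 normr0 -of_real0 of_realK mul0r.
apply/eqP; rewrite eq_le le_normZ/=.
have aV : real_part `|a| * real_part `|a^-1| = 1.
  rewrite -(@rnormZ _ _ K^o a a^-1) -[a *: _]/(a * a^-1) divff//.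
  by rewrite /rnorm normr1 -(of_realK (k := k) 1); case: k.
rewrite -{1}[f](scalerK a0) -[leRHS]mul1r -aV -mulrA.
by rewrite ler_wpM2l ?le_normZ// (rnorm_ge0 (a : K^o)).
Qed.

Lemma dual_norm_bound f x : rnorm (f x) <= dual_norm f * rnorm x.
Proof.
have [->|x0] := eqVneq x 0; first by rewrite linear0 !rnorm0 mulr0.
have nx : 0 < rnorm x.
  rewrite lt_neqAle rnorm_ge0 andbT eq_sym.
  by apply: contra x0 => /eqP/rnorm0_eq0/eqP.
pose c : K := of_real k (rnorm x)^-1.
have nc : real_part `|c| = (rnorm x)^-1.
  by rewrite ger0_norm ?of_realK// -of_real0 ler_of_real invr_ge0 ltW.
rewrite -ler_pdivrMr// mulrC -nc -rnormZ -linearZ.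
by apply: dual_norm_ub; rewrite rnormZ nc mulVf ?gt_eqF.
Qed.

Lemma dual_norm0_eq0 f : dual_norm f = 0 -> f = 0.
Proof.
move=> f0; apply/val_inj/funext => x; apply: rnorm0_eq0.
apply/eqP; rewrite eq_le rnorm_ge0 andbT.
by rewrite -(mul0r (rnorm x)) -f0 dual_norm_bound.
Qed.

Let norm f : K := of_real k (dual_norm f).

Let ler_normD f g : norm (f + g) <= norm f + norm g.
Proof. by rewrite /norm -of_realD ler_of_real ler_dual_normD. Qed.

Let normrZ (a : K) f : norm (a *: f) = `|a| * norm f.
Proof. by rewrite /norm dual_normZ of_realM real_partK. Qed.

Let normr0_eq0 f : norm f = 0 -> f = 0.
Proof.
move=> f0; apply: dual_norm0_eq0.
by rewrite -[LHS](of_realK (k := k)) -/(norm f) f0 -of_real0 of_realK.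
Qed.

(* The norm of [f : dual V] is [dual_norm f], seen as an element of K. *)
HB.instance Definition _ :=
  Lmodule_isNormed.Build K dual ler_normD normrZ normr0_eq0.

Lemma rnorm_dualE f : rnorm f = dual_norm f.
Proof. exact: of_realK. Qed.

End continuous_dual.
Arguments dual_pred {R k} V.

Section bidual.
Context {R : realType} {k : scalar_kind} (V : normedModType (scalars R k)).
Local Notation K := (scalars R k).

Definition eval_at (x : V) : dual V -> K^o := fun f => f x.

Lemma eval_at_dual (x : V) : eval_at x \in dual_pred (dual V).
Proof.
have lin_ev : scalar (eval_at x) by [].
pose ev : {linear dual V -> K^o} := HB.pack (eval_at x)
  (GRing.isLinear.Build _ _ _ _ _ lin_ev).
apply/asboolP; split=> //.
apply: (@bounded_linear_continuous _ _ _ ev).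
apply/linear_boundedP; near=> r => f.
rewrite (@le_trans _ _ (`|x| * `|f|))//; last first.
  by rewrite ler_wpM2r//; near: r; apply: nbhs_pinfty_ge; exact: normr_real.
rewrite -!rnormE -of_realM ler_of_real mulrC rnorm_dualE.
exact: dual_norm_bound.
Unshelve. all: by end_near. Qed.

Definition canonical_map (x : V) : dual (dual V) := Dual (eval_at_dual x).

(* [V] is reflexive when the canonical isometry V -> V** is onto. *)
Definition reflexive_space := range canonical_map = [set: dual (dual V)].

End bidual.

Section subspace.
Context {R : realType} {k : scalar_kind} {V : normedModType (scalars R k)}.
Local Notation K := (scalars R k).
Variable X : submodClosed V.

Record subspace_of := SubspaceOf { sub_vec : V; _ : sub_vec \in X }.

HB.instance Definition _ := [isSub for sub_vec].
HB.instance Definition _ := [Choice of subspace_of by <:].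
HB.instance Definition _ := [SubChoice_isSubLmodule of subspace_of by <:].

Let norm (x : subspace_of) : K := `|sub_vec x|.

Let ler_normD x y : norm (x + y) <= norm x + norm y.
Proof. exact: ler_normD. Qed.

Let normrZ (a : K) x : norm (a *: x) = `|a| * norm x.
Proof. exact: normrZ. Qed.

Let normr0_eq0 x : norm x = 0 -> x = 0.
Proof. by move=> /normr0_eq0 x0; exact/val_inj. Qed.

HB.instance Definition _ :=
  Lmodule_isNormed.Build K subspace_of ler_normD normrZ normr0_eq0.

End subspace.

Section norming_and_total.
Context {R : realType} {k : scalar_kind}.
Local Notation K := (scalars R k).

Definition is_norm (V : lmodType K) (p : V -> R) :=
  [/\ forall x y, p (x + y) <= p x + p y,
      forall (a : K) x, p (a *: x) = rnorm (a : K^o) * p x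
    & forall x, p x = 0 -> x = 0].

Definition equivalent_norm (V : normedModType K) (p : V -> R) : Prop :=
  is_norm p /\
  exists c C : R, [/\ 0 < c, 0 < C &
    forall x, c * rnorm x <= p x /\ p x <= C * rnorm x].

Context {E : normedModType K}.
Implicit Types (X : submodClosed E) (Z : submodClosed (dual E)).

(* The suprema below range over nonempty bounded sets, since |f x| is at most
   |f| |x|, so the real-valued [sup] is the genuine supremum. *)

(* Z, in E*, is norming for X, in E. *)
Definition norming_for_sub Z X := equivalent_norm (fun x : subspace_of X =>
  sup [set rnorm ((f : dual E) (sub_vec x)) |
         f in [set` Z] `&` unit_ball (dual E)]).

(* X, in E, is norming for Z, in E*; B_X is used in place of the unit ball of
   the (isometric) image of X in E**. *)
Definition norming_for_dual X Z := equivalent_norm (fun f : subspace_of Z =>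
  sup [set rnorm (sub_vec f x) | x in [set` X] `&` unit_ball E]).

Definition preannihilator Z : set E :=
  [set x | forall f : dual E, f \in Z -> f x = 0].

Definition annihilator X : set (dual E) :=
  [set f : dual E | forall x, x \in X -> f x = 0].

Definition total_over_sub Z X := [set` X] `&` preannihilator Z = [set 0].

Definition total_over_dual X Z := annihilator X `&` [set` Z] = [set 0].

Definition direct_sum_decomposition (A B : set E) :=
  A `&` B = [set 0] /\ [set x + y | x in A & y in B] = [set: E].

End norming_and_total.

(* The weak-star topology sigma(E*, E): the coarsest topology on [dual E] that
   makes all the evaluations [fun f => f x] continuous. *)
Definition weak_star (R : realType) (k : scalar_kind)
    (E : normedModType (scalars R k)) : topologicalType :=
  sup_topology (fun x : E => Topological.on
    (initial_topology (fun f : dual E => (f x : (scalars R k)^o)))).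

Definition weak_star_closed (R : realType) (k : scalar_kind)
    (E : normedModType (scalars R k)) (A : set (dual E)) :=
  @closed (weak_star E) A.

(* Main.v *)
Require Import Defs.
From HB Require Import structures.
From mathcomp Require Import all_boot all_order all_algebra.
From mathcomp Require Import all_classical all_reals all_analysis.
From mathcomp Require Import complex ring lra.

Set Implicit Arguments.
Unset Strict Implicit.
Unset Printing Implicit Defensive.

Import Order.TTheory GRing.Theory Num.Theory.
Import numFieldNormedType.Exports.

Local Open Scope classical_set_scope.
Local Open Scope ring_scope.

(** Everything is read off the restriction map from Z to X*, f |-> f|X, which
    has norm at most 1. X is norming for Z exactly when this map is bounded
    below, and X is total over Z exactly when it is injective. Dually, Z is
    norming for (total over) X exactly when evaluation on Z, from X to Z*, is
    bounded below (injective). Since X is reflexive, that second map is the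
    adjoint of the first one, and each of the four conditions turns out to say
    that restriction is an isomorphism of Z onto X*, a property called
    [restriction_isomorphic] below.

    To get surjectivity out of (1) or (2), fix s >= 0 and consider on X* the
    seminorm p(g), the infimum over f in Z of s |f| + |g - f|X|. By Hahn-Banach
    and reflexivity p(g) <= |g(x)| for a point x of X whose evaluation is
    dominated by p, hence |f(x)| <= s |f| for every f in Z
    ([reflexive_range_approx]). Under (1) take s = 0: totality forces x = 0, so
    restrictions are dense in X*, and the lower bound controls the norms of
    the approximants. Under (2) take s proportional to the norming constant:
    x is then small, so p(g) is small compared with |g|. In both cases every g
    is approximated within |g|/2 by the restriction of an f in Z with
    |f| <= C |g|, and iterating as in the open mapping theorem gives exact
    preimages, because E* is complete and Z is closed ([lifting_of_approx]).
    This avoids both Krein-Smulian and the closed range theorem.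

    Conversely, an isomorphism makes both norming conditions hold. For (4),
    given e in E, the functional that sends the restriction of f to f(e) is
    evaluation at some x in X by reflexivity, and e - x is in the preannihilator
    of Z; this is the decomposition. It follows that Z is the annihilator of
    its preannihilator, hence weak-star closed.

    From (4) back to (1): if E is the sum of X and the preannihilator of Z, the
    set of f in Z with |f|X| <= 1 is pointwise bounded on E, hence norm
    bounded by the uniform boundedness principle.

    Hahn-Banach and uniform boundedness are proved over R and C at once. *)

(** * Real scalars inside the scalar field *)

Section real_scaling.
Context {R : realType} {k : scalar_kind}.
Local Notation K := (scalars R k).

Lemma of_real1 : of_real k (1 : R) = 1.
Proof. by case: k. Qed.

Lemma of_realN (a : R) : of_real k (- a) = - of_real k a.
Proof. by case: k => //=; apply/eqP; rewrite eq_complex /= oppr0 !eqxx. Qed.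

Lemma rnorm_of_real (a : R) : rnorm (of_real k a : K^o) = `|a|.
Proof.
wlog a0 : a / 0 <= a => [wa|].
  have [/wa//|/ltW a0] := leP 0 a.
  by rewrite -normrN -wa ?oppr_ge0// of_realN /rnorm normrN.
by rewrite /rnorm !ger0_norm ?of_realK// -of_real0 ler_of_real.
Qed.

End real_scaling.

(** * The Hahn-Banach theorem for seminorms *)

Section real_hahn_banach.
Context {R : realType} {k : scalar_kind} {V : lmodType (scalars R k)}.
Local Notation K := (scalars R k).
Variable p : V -> R.
Hypothesis pD : forall x y, p (x + y) <= p x + p y.
Hypothesis pZ : forall (a : K) x, p (a *: x) = rnorm (a : K^o) * p x.

Local Notation "a *r: x" := (of_real k a *: x) (at level 40).

Let p_ge0 x : 0 <= p x.
Proof.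
have := pD x (- x); rewrite subrr -(scale0r x) -scaleN1r !pZ rnorm0 mul0r.
by rewrite /rnorm normrN1 -of_real1 of_realK mul1r -mulr2n pmulrn_lge0.
Qed.

Let pZr a x : p (a *r: x) = `|a| * p x.
Proof. by rewrite pZ rnorm_of_real. Qed.

Let p_rescale a x y : 0 < a -> a * p (a^-1 *r: x + y) = p (x + a *r: y).
Proof.
move=> a0; rewrite -{1}(gtr0_norm a0) -pZr scalerDr scalerA -of_realM.
by rewrite divff ?gt_eqF// of_real1 scale1r.
Qed.

(** A partial real linear functional below p, as a graph. The empty set
    satisfies the definition vacuously, as the union of an empty chain must;
    the last clause keeps the prescribed value at v0 in all nonempty graphs.
    Single-valuedness follows from domination by a seminorm. *)
Let dominated_graph (v0 : V) (G : set (V * R)) :=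
  [/\ forall a x y s t, G (x, s) -> G (y, t) -> G (x + a *r: y, s + a * t),
      forall x s, G (x, s) -> s <= p x
    & G !=set0 -> G (v0, p v0)].

Let dominated_graph0 v0 G : dominated_graph v0 G -> G !=set0 -> G (0, 0).
Proof.
move=> [GD _ _] [[x s] Gx].
have := GD (-1) _ _ _ _ Gx Gx.
by rewrite of_realN of_real1 scaleN1r mulN1r !subrr.
Qed.

Let dominated_line v0 :
  dominated_graph v0 [set z | exists a, z = (a *r: v0, a * p v0)].
Proof.
split.
- move=> a x y s t [b [-> ->]] [c [-> ->]]; exists (b + a * c).
  by rewrite of_realD of_realM scalerDl scalerA mulrDl mulrA.
- by move=> x s [a [-> ->]]; rewrite pZr ler_wpM2r// ler_norm.
- by exists 1; rewrite of_real1 scale1r mul1r.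
Qed.

(** The usual one-step extension: the value c at v must separate the numbers
    s - p (x - v) from the numbers p (y + v) - t, and their supremum does. *)
Let dominated_extend v0 G v : dominated_graph v0 G -> G !=set0 ->
  exists c, dominated_graph v0 [set z | exists x s a,
    [/\ G (x, s) & z = (x + a *r: v, s + a * c)]].
Proof.
move=> gG G0; have G00 := dominated_graph0 gG G0; case: gG => GD Gp Gv0.
have sep x s y t : G (x, s) -> G (y, t) -> s - p (x - v) <= p (y + v) - t.
  move=> Gx Gy; rewrite lerBlDr addrAC lerBrDr.
  have := Gp _ _ (GD 1 _ _ _ _ Gx Gy).
  rewrite of_real1 scale1r mul1r => /le_trans; apply.
  rewrite -[x](subrK v) -addrA [v + y]addrC addrC.
  by rewrite (le_trans (pD _ _))// subrK.
pose A := [set u | exists x s, G (x, s) /\ u = s - p (x - v)].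
have ubA y t : G (y, t) -> ubound A (p (y + v) - t).
  by move=> Gy _ [x [s [Gx ->]]]; exact: sep.
have A0 : A !=set0 by exists (0 - p (0 - v)), 0, 0.
exists (sup A); split.
- move=> a x y s t [x1 [s1 [b [Gx [-> ->]]]]] [y1 [t1 [c [Gy [-> ->]]]]].
  exists (x1 + a *r: y1), (s1 + a * t1), (b + a * c); split; first exact: GD.
  congr pair; last by rewrite mulrDl mulrDr mulrA addrACA.
  by rewrite of_realD of_realM scalerDl scalerDr scalerA addrACA.
- move=> x s [y [t [a [Gy [-> ->]]]]].
  have Gs b : G (b *r: y, b * t).
    by have := GD b _ _ _ _ G00 Gy; rewrite !add0r.
  have [a0|a0|->] := ltgtP a 0; last first.
  + by rewrite of_real0 scale0r mul0r !addr0 Gp.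
  + have : sup A <= p (a^-1 *r: y + v) - a^-1 * t.
      by apply: ge_sup => //; exact: ubA.
    by rewrite lerBrDr -(ler_pM2l a0) p_rescale// mulrDr mulVKf ?gt_eqF// addrC.
  + have a1 : 0 < - a by rewrite oppr_gt0.
    have : (- a)^-1 * t - p ((- a)^-1 *r: y - v) <= sup A.
      apply: ub_le_sup; first by exists (p (0 + v) - 0); exact: ubA.
      by exists ((- a)^-1 *r: y), ((- a)^-1 * t).
    rewrite lerBlDr -(ler_pM2l a1) mulrDr p_rescale// mulVKf ?gt_eqF//.
    by rewrite scalerN of_realN scaleNr opprK mulNr addrC -lerBlDr opprK.
- move=> _; exists v0, (p v0), 0; split; first exact: Gv0.
  by rewrite of_real0 scale0r mul0r !addr0.
Qed.

Lemma real_hahn_banach (v0 : V) : exists phi : V -> R,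
  [/\ forall a x y, phi (a *r: x + y) = a * phi x + phi y,
      forall x, phi x <= p x & phi v0 = p v0].
Proof.
have [F FP Ftot|G [gG Gmax]] := @Zorn_bigcup _ (dominated_graph v0).
  split.
  - move=> a x y s t [A FA Ax] [B FB By].
    have [AB|BA] := Ftot _ _ FA FB.
      by exists B => //; have [+ _ _] := FP _ FB; apply => //; exact: AB.
    by exists A => //; have [+ _ _] := FP _ FA; apply => //; exact: BA.
  - by move=> x s [A FA Ax]; have [_ + _] := FP _ FA; exact.
  - move=> [z [A FA Az]]; exists A => //; have [_ _] := FP _ FA; apply.
    by exists z.
have G0 : G !=set0.
  apply/set0P/negP => /eqP G0.
  apply: (Gmax _ _ (dominated_line v0)); rewrite G0; split=> [|line0].
    exact: sub0set.
  by apply: (line0 (v0, p v0)); exists 1; rewrite of_real1 scale1r mul1r.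
have G00 := dominated_graph0 gG G0; have [GD Gp Gv0] := gG.
have total v : exists s, G (v, s).
  apply: contrapT => noGv; have [c gB] := dominated_extend v gG G0.
  apply: (Gmax _ _ gB); split.
    move=> [x s] Gx; exists x, s, 0; split=> //.
    by rewrite of_real0 scale0r mul0r !addr0.
  move=> BG; apply: noGv; exists c; apply: BG; exists 0, 0, 1; split=> //.
  by rewrite of_real1 scale1r mul1r !add0r.
have uniq x s t : G (x, s) -> G (x, t) -> s = t.
  move=> Gs Gt; apply/eqP; rewrite eq_le.
  have half u w : G (x, u) -> G (x, w) -> u <= w.
    move=> Gu Gw; rewrite -subr_le0; have := Gp _ _ (GD (-1) _ _ _ _ Gu Gw).
    rewrite of_realN of_real1 scaleN1r mulN1r subrr.
    by rewrite -(scale0r x) pZ rnorm0 mul0r.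
  by rewrite !half.
have [phi Gphi] := choice total; exists phi; split.
- move=> a x y; apply: (uniq (a *r: x + y)); first exact: Gphi.
  by rewrite addrC [a * _ + _]addrC; apply: GD; exact: Gphi.
- by move=> x; exact: Gp.
- by apply: (uniq v0) => //; exact: Gv0.
Qed.

End real_hahn_banach.
Section scalar_parts.
Context {R : realType} {k : scalar_kind}.
Local Notation K := (scalars R k).

Lemma real_part_le_rnorm (z : K) : real_part z <= rnorm (z : K^o).
Proof.
case: k z => z; first exact: ler_norm.
rewrite (le_trans (ler_norm _))// -(@ler_of_real _ ComplexScalars) rnormE.
exact: normc_ge_Re.
Qed.

(** Rotating by a phase turns bounds on real parts into bounds on moduli. *)
Lemma exists_phase (z : K) :
  exists2 u : K, rnorm (u : K^o) = 1 & real_part (u * z) = rnorm (z : K^o).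
Proof.
have [->|z0] := eqVneq z 0.
  by exists 1; rewrite ?mulr0 /rnorm ?normr1 ?normr0// -of_real1 of_realK.
exists (`|z| / z); last by rewrite divfK.
by rewrite /rnorm normrM normfV normr_id divff ?normr_eq0// -of_real1 of_realK.
Qed.

(** Over C this is the Bohnenblust-Sobczyk complexification. *)
Lemma real_part_linear_ext (V : lmodType K) (phi : V -> R) :
  (forall a x y, phi (of_real k a *: x + y) = a * phi x + phi y) ->
  exists2 Phi : V -> K^o, scalar Phi & forall x, real_part (Phi x) = phi x.
Proof.
case: k V phi => V phi phiZD; first by exists phi.
have phiD x y : phi (x + y) = phi x + phi y.
  by have := phiZD 1 x y; rewrite of_real1 scale1r mul1r.
have phi0 : phi 0 = 0 by apply: (addrI (phi 0)); rewrite -phiD !addr0.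
have phiZ a x : phi (of_real ComplexScalars a *: x) = a * phi x.
  by rewrite -[X in phi X]addr0 phiZD phi0 addr0.
pose C := scalars R ComplexScalars; pose ii : C := Complex 0 1.
(* The real part phi of a complex linear Phi determines Phi, because
   Im (Phi x) = - Re (Phi (i x)). *)
exists (fun x => Complex (phi x) (- phi (ii *: x)) : C) => //.
move=> c x y; rewrite scalerDr !phiD.
have cE : c = of_real _ (complex.Re c) + of_real _ (complex.Im c) * ii :> C.
  case: c => a b; apply/eqP; rewrite eq_complex /=.
  by rewrite !(mulr0, mul0r, mulr1, subr0, addr0, add0r) !eqxx.
have iiE : ii * ii = -1.
  apply/eqP; rewrite eq_complex /=.
  by rewrite !(mulr0, mul0r, mulr1, subr0, addr0, add0r, sub0r, oppr0) !eqxx.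
have phic w :
    phi (c *: w) = complex.Re c * phi w + complex.Im c * phi (ii *: w).
  by rewrite {1}cE scalerDl phiD phiZ -scalerA phiZ.
have phiic w : phi (ii *: (c *: w)) =
    complex.Re c * phi (ii *: w) - complex.Im c * phi w.
  rewrite scalerA mulrC -scalerA phic scalerA iiE.
  by rewrite -of_real1 -of_realN phiZ mulN1r mulrN.
rewrite phic phiic; case: c {cE phic phiic} => a b.
by apply/eqP; rewrite eq_complex /=; apply/andP; split; apply/eqP; ring.
Qed.

End scalar_parts.

(** The bound at v is an inequality because p v is obtained as the real part of
    [Phi v]; together with the last clause it gives |Phi v| = p v. *)
Lemma hahn_banach_seminorm (R : realType) (k : scalar_kind)
    (V : lmodType (scalars R k)) (p : V -> R)
    (pD : forall x y, p (x + y) <= p x + p y)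
    (pZ : forall (a : scalars R k) x,
       p (a *: x) = rnorm (a : (scalars R k)^o) * p x)
    (v : V) :
  exists Phi : V -> (scalars R k)^o,
    [/\ scalar Phi, p v <= rnorm (Phi v) & forall x, rnorm (Phi x) <= p x].
Proof.
have [phi [phiZD phi_le phiv]] := real_hahn_banach pD pZ v.
have [Phi lin PhiE] := real_part_linear_ext phiZD.
exists Phi; split=> // [|x]; first by rewrite -phiv -PhiE real_part_le_rnorm.
have [u u1 <-] := exists_phase (Phi x).
have -> : u * Phi x = Phi (u *: x).
  have := lin u x 0; have := lin (-1) 0 0.
  by rewrite scaleN1r oppr0 addr0 mulN1r addNr => ->; rewrite !addr0.
by rewrite PhiE (le_trans (phi_le _))// pZ u1 mul1r.
Qed.

(** * Completeness along geometrically convergent sequences *)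

Section geometric_sequences.
Context {R : realType} {k : scalar_kind}.
Local Notation K := (scalars R k).

Lemma ltr_of_real (a b : R) : (of_real k a < of_real k b) = (a < b).
Proof. by rewrite !lt_neqAle ler_of_real (inj_eq (can_inj of_realK)). Qed.

Lemma rnormN (V : normedModType K) (x : V) : rnorm (- x) = rnorm x.
Proof. by rewrite /rnorm normrN. Qed.

Lemma rnorm_gt0 (V : normedModType K) (x : V) : x != 0 -> 0 < rnorm x.
Proof.
move=> x0; rewrite lt_neqAle rnorm_ge0 andbT eq_sym.
by apply: contra x0 => /eqP/rnorm0_eq0/eqP.
Qed.

Lemma rnorm_le0 (V : normedModType K) (x : V) : rnorm x <= 0 -> x = 0.
Proof.
by move=> x0; apply/rnorm0_eq0/eqP; rewrite eq_le x0 rnorm_ge0.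
Qed.

Lemma rnormB (V : normedModType K) (x y : V) : rnorm (x - y) = rnorm (y - x).
Proof. by rewrite -rnormN opprB. Qed.

Lemma ler_rnorm_dist (V : normedModType K) (y x z : V) :
  rnorm (x - z) <= rnorm (x - y) + rnorm (y - z).
Proof. by rewrite (le_trans _ (ler_rnormD _ _))// addrA subrK. Qed.

Lemma geometric_le (A q e : R) : 0 <= q < 1 -> 0 < e ->
  exists N, forall n, (N <= n)%N -> A * q ^+ n <= e.
Proof.
move=> /andP[q0 q1] e0; have : `|q| < 1 by rewrite ger0_norm.
move=> /(cvg_geometric A)/cvgr0_norm_le/(_ e e0)[N _ NP].
exists N => n Nn; exact: le_trans (ler_norm _) (NP n Nn).
Qed.

Lemma geometric_le0 (A q x : R) : 0 <= q < 1 ->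
  (forall n, x <= A * q ^+ n) -> x <= 0.
Proof.
move=> q01 xA; apply/ler_addgt0Pr => e e0; rewrite add0r.
have [N NP] := geometric_le A q01 e0.
exact: le_trans (xA N) (NP N (leqnn N)).
Qed.

Definition geometric_steps (V : normedModType K) (A q : R) (u : nat -> V) :=
  forall n, rnorm (u n.+1 - u n) <= A * q ^+ n.

(** All limits taken in the proof are of this kind. The explicit rate makes the
    property pass from the scalars to the dual space pointwise, with no
    uniformity argument. *)
Definition geometrically_complete (V : normedModType K) :=
  forall (u : nat -> V) (A q : R), 0 <= q < 1 -> geometric_steps A q u ->
  exists l, forall n, rnorm (l - u n) <= A / (1 - q) * q ^+ n.

Lemma geometric_steps_dist (V : normedModType K) (A q : R) (u : nat -> V) n m :
  0 <= q < 1 -> geometric_steps A q u -> (n <= m)%N ->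
  rnorm (u m - u n) <= A / (1 - q) * q ^+ n.
Proof.
move=> /andP[q0 q1] uA nm; have q1' : 1 - q != 0 by rewrite subr_eq0 gt_eqF.
have A0 : 0 <= A.
  by have := uA 0; rewrite expr0 mulr1; exact: le_trans (rnorm_ge0 _).
have tele : rnorm (u m - u n) <= A / (1 - q) * (q ^+ n - q ^+ m).
  rewrite -(subnKC nm); elim: (m - n)%N => [|j ih].
    by rewrite addn0 !subrr mulr0 rnorm0.
  rewrite (le_trans (ler_rnorm_dist (u (n + j)) _ _))// addnS.
  rewrite (le_trans (lerD (uA _) ih))// exprS.
  by rewrite le_eqVlt; apply/orP; left; apply/eqP; field.
apply: le_trans tele _; apply: ler_wpM2l.
  by rewrite divr_ge0// subr_ge0 ltW.
by rewrite lerBlDr lerDl exprn_ge0.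
Qed.

(** Any limit, however slowly it is known to be approached, satisfies the
    optimal geometric estimate. *)
Lemma geometric_limit_dist (V : normedModType K) (A q : R) (u : nat -> V) l :
  0 <= q < 1 -> geometric_steps A q u ->
  (forall e, 0 < e -> exists N, forall n, (N <= n)%N -> rnorm (l - u n) <= e) ->
  forall n, rnorm (l - u n) <= A / (1 - q) * q ^+ n.
Proof.
move=> q01 uA ul n; apply/ler_addgt0Pr => e /ul[N uN].
rewrite (le_trans (ler_rnorm_dist (u (maxn N n)) _ _))// addrC lerD//.
  by apply: geometric_steps_dist; rewrite ?leq_maxr.
by rewrite uN ?leq_maxl.
Qed.

Lemma complete_geometrically_complete (V : completeNormedModType K) :
  geometrically_complete V.
Proof.
move=> u A q q01 uA.
have cu : cvg (u @ \oo).
  apply: cauchy_cvg; apply: cauchy_exP => e e0.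
  have re0 : 0 < real_part e.
    by rewrite -ltr_of_real real_partK ?ltW// of_real0.
  have [N NP] := geometric_le (A / (1 - q)) q01 (divr_gt0 re0 (ltr0n R 2)).
  exists (u N), N => // n /= Nn.
  rewrite -ball_normE /= -rnormE -(real_partK (ltW e0)) ltr_of_real rnormB.
  apply: le_lt_trans (geometric_steps_dist q01 uA Nn) _.
  by rewrite (le_lt_trans (NP N (leqnn N)))//; lra.
exists (lim (u @ \oo)); apply: geometric_limit_dist => // e e0.
have e0' : 0 < of_real k e by rewrite -(of_real0 (k := k)) ltr_of_real.
have /cvgrPdist_le/(_ _ e0')[N _ NP] := cu.
by exists N => n Nn; rewrite -(ler_of_real (k := k)) rnormE; exact: NP.
Qed.

End geometric_sequences.

Section complex_modulus.
Context {R : realType}.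
Local Notation C := (scalars R ComplexScalars).

Lemma rnorm_complexE (z : C) :
  rnorm (z : C^o) = Num.sqrt (complex.Re z ^+ 2 + complex.Im z ^+ 2).
Proof. by rewrite /rnorm normc_def. Qed.

Lemma ler_Re_rnorm (z : C) : `|(complex.Re z : R)| <= rnorm (z : C^o).
Proof.
rewrite rnorm_complexE -sqrtr_sqr; apply: ler_wsqrtr.
by rewrite lerDl sqr_ge0.
Qed.

Lemma ler_Im_rnorm (z : C) : `|(complex.Im z : R)| <= rnorm (z : C^o).
Proof.
rewrite rnorm_complexE -sqrtr_sqr; apply: ler_wsqrtr.
by rewrite lerDr sqr_ge0.
Qed.

(** The elementary bound by the sum is all that componentwise convergence
    needs, since [geometric_limit_dist] restores the right constant. *)
Lemma ler_rnorm_ReIm (z : C) :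
  rnorm (z : C^o) <= `|(complex.Re z : R)| + `|(complex.Im z : R)|.
Proof.
have h : 0 <= `|(complex.Re z : R)| + `|(complex.Im z : R)| by rewrite addr_ge0.
rewrite rnorm_complexE -[leRHS](ger0_norm h) -sqrtr_sqr; apply: ler_wsqrtr.
rewrite sqrrD !real_normK ?num_real// lerD2r lerDl.
by rewrite mulrn_wge0// mulr_ge0.
Qed.

End complex_modulus.

Lemma scalars_geometrically_complete (R : realType) (k : scalar_kind) :
  geometrically_complete (scalars R k)^o.
Proof.
have Rc : @geometrically_complete R RealScalars R^o.
  exact: (@complete_geometrically_complete R RealScalars R^o).
case: k => // u A q q01 uA.
have [|a aP] := Rc (fun n => complex.Re (u n)) A q q01.
  move=> n; apply: le_trans (uA n); apply: le_trans (ler_Re_rnorm _).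
  by case: (u n.+1) (u n) => [? ?] [? ?].
have [|b bP] := Rc (fun n => complex.Im (u n)) A q q01.
  move=> n; apply: le_trans (uA n); apply: le_trans (ler_Im_rnorm _).
  by case: (u n.+1) (u n) => [? ?] [? ?].
exists (Complex a b); apply: geometric_limit_dist => // e e0.
have [N NP] := geometric_le (A / (1 - q)) q01 (divr_gt0 e0 (ltr0n R 2)).
exists N => n Nn; apply: le_trans (ler_rnorm_ReIm _) _.
have -> : complex.Re ((Complex a b : scalars R ComplexScalars) - u n) =
    a - complex.Re (u n).
  by case: (u n).
have -> : complex.Im ((Complex a b : scalars R ComplexScalars) - u n) =
    b - complex.Im (u n).
  by case: (u n).
have := lerD (le_trans (aP n) (NP n Nn)) (le_trans (bP n) (NP n Nn)).
by rewrite -splitr.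
Qed.

(** * The dual space is complete *)

Section dual_space.
Context {R : realType} {k : scalar_kind}.
Local Notation K := (scalars R k).
Implicit Types V : normedModType K.

Lemma bounded_dual_pred V (f : V -> K^o) (M : R) :
  scalar f -> (forall x, rnorm (f x) <= M * rnorm x) -> f \in dual_pred V.
Proof.
move=> lin_f fM.
pose g : {linear V -> K^o} := HB.pack f (GRing.isLinear.Build _ _ _ _ _ lin_f).
apply/asboolP; split=> //.
apply: (@bounded_linear_continuous _ _ _ g); apply/linear_boundedP.
near=> r => x; rewrite (@le_trans _ _ (of_real k M * `|x|))//.
  by rewrite -!rnormE -of_realM ler_of_real; exact: fM.
rewrite ler_wpM2r//; near: r; apply: nbhs_pinfty_ge.
by case: k M {fM} => M; rewrite ?num_real//; apply/complex_realP; exists M.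
Unshelve. all: by end_near. Qed.

Lemma dualB_apply V (f g : dual V) x : (f - g) x = f x - g x.
Proof. by []. Qed.

Lemma dual_geometrically_complete V : geometrically_complete (dual V).
Proof.
move=> u A q q01 uA.
have ptwise (x : V) : exists l : K^o, forall n,
    rnorm (l - u n x) <= A / (1 - q) * rnorm x * q ^+ n.
  have [|l lP] :=
      @scalars_geometrically_complete _ _ (u^~ x) (A * rnorm x) q q01.
    move=> n; rewrite -dualB_apply (le_trans (dual_norm_bound _ _))//.
    by rewrite mulrAC ler_wpM2r ?rnorm_ge0// -rnorm_dualE.
  by exists l => n; rewrite (mulrAC A).
have [F FP] := choice ptwise.
have Flin : scalar F.
  move=> a x y; apply/eqP; rewrite -subr_eq0; apply/eqP/(@rnorm_le0 _ _ K^o).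
  pose B := A / (1 - q).
  apply: (@geometric_le0 _ (B * rnorm (a *: x + y) +
    (rnorm (a : K^o) * (B * rnorm x) + B * rnorm y)) q) => // n.
  have -> : F (a *: x + y) - (a * F x + F y) =
    (F (a *: x + y) - u n (a *: x + y)) - (a *: (F x - u n x) + (F y - u n y)).
    by rewrite dual_linear -[a *: (F x - _)]/(a * (F x - u n x)); ring.
  rewrite (le_trans (ler_rnormD _ _))// rnormN mulrDl lerD//.
  rewrite (le_trans (ler_rnormD _ _))// mulrDl lerD//.
  by rewrite rnormZ -mulrA ler_wpM2l// (rnorm_ge0 (a : K^o)).
have FM x : rnorm (F x) <= (A / (1 - q) + dual_norm (u 0)) * rnorm x.
  rewrite -[F x](subrK (u 0 x)) (le_trans (ler_rnormD _ _))// mulrDl lerD//.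
    by have := FP x 0; rewrite expr0 mulr1.
  exact: dual_norm_bound.
exists (Dual (bounded_dual_pred Flin FM)) => n.
rewrite rnorm_dualE; apply: dual_norm_le => x x1.
rewrite dualB_apply (le_trans (FP x n))// mulrAC ler_piMr//.
have := uA 0; rewrite expr0 mulr1 => /(le_trans (rnorm_ge0 _)) A0.
case/andP: q01 => q0 q1.
by rewrite mulr_ge0 ?exprn_ge0// divr_ge0// subr_ge0 ltW.
Qed.

End dual_space.

(** * The uniform boundedness principle *)

Section uniform_boundedness.
Context {R : realType} {k : scalar_kind}.
Local Notation K := (scalars R k).

Lemma dual_norm_approx (V : normedModType K) (f : dual V) (t : R) :
  0 <= t < 1 -> exists2 x, rnorm x <= 1 & t * dual_norm f <= rnorm (f x).
Proof.
move=> /andP[t0 t1]; have [f0|f0] := eqVneq (dual_norm f) 0.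
  by exists 0; rewrite ?rnorm0 ?ler01// f0 mulr0 rnorm_ge0.
have fgt0 : 0 < dual_norm f by rewrite lt_neqAle eq_sym f0 dual_norm_ge0.
have e0 : 0 < (1 - t) * dual_norm f by rewrite mulr_gt0 ?subr_gt0.
have [_ [x x1 <-] /ltW xf] := sup_adherent e0 (dual_norm_has_sup f).
exists x => //; apply: le_trans xf.
by rewrite -/(dual_norm f) mulrBl mul1r opprB addrCA subrr addr0.
Qed.

(** If f is at least t |f| at the unit vector v, then its values at x + r v and
    x - r v differ by 2 r t |f| or more, so one of them is large: no closed
    ball of radius r can hide the norm of f. *)
Lemma dual_norm_hump (V : normedModType K) (f : dual V) (x : V) (r : R) :
  0 <= r -> exists2 y,
    rnorm (y - x) <= r & 2 / 3 * r * dual_norm f <= rnorm (f y).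
Proof.
move=> r0; have [|v v1 fv] := @dual_norm_approx _ f (2 / 3); first lra.
have nrv : rnorm (of_real k r *: v) <= r.
  rewrite rnormZ -/(rnorm (of_real k r : K^o)) rnorm_of_real.
  by rewrite ger0_norm// ler_piMr.
have sum : 2 * (2 / 3 * r * dual_norm f) <=
    rnorm (f (x + of_real k r *: v)) + rnorm (f (x - of_real k r *: v)).
  have : rnorm (f (x + of_real k r *: v) - f (x - of_real k r *: v)) =
      2 * r * rnorm (f v).
    rewrite -linearB opprD opprK addrACA subrr add0r.
    rewrite -mulr2n -scaler_nat scalerA linearZ rnormZ -/(rnorm (_ : K^o)).
    have -> : 2 * of_real k r = of_real k (2 * r) :> K.
      by rewrite !mulr_natl !mulr2n of_realD.
    by rewrite rnorm_of_real ger0_norm// mulr_ge0.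
  have := ler_rnormD (f (x + of_real k r *: v)) (- f (x - of_real k r *: v)).
  rewrite rnormN => + fE; rewrite fE; apply: le_trans.
  by have := ler_wpM2l r0 fv; lra.
have [le1|/ltW lt1] :=
    leP (2 / 3 * r * dual_norm f) (rnorm (f (x + of_real k r *: v))).
  by exists (x + of_real k r *: v) => //; rewrite addrC addKr.
exists (x - of_real k r *: v); first by rewrite addrC addKr rnormN.
lra.
Qed.

(** Sokal's gliding hump. Were the family unbounded, pick f_n with
    |f_n| >= 6 n 3^n and move by at most 3^-n from u_n to a u_(n+1) where
    |f_n| >= (2/3) 3^-n |f_n|. The later moves add up to at most (1/2) 3^-n, so
    |f_n l| >= (1/6) 3^-n |f_n| >= n at the limit l. *)
Lemma uniform_boundedness (V : completeNormedModType K) (F : set (dual V)) :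
  (forall x, exists M, forall f, F f -> rnorm (f x) <= M) ->
  exists C, forall f, F f -> dual_norm f <= C.
Proof.
move=> Fpt; apply: contrapT => unbounded.
have large C : exists f, F f /\ C <= dual_norm f.
  apply: contrapT => nf; apply: unbounded; exists C => f Ff.
  by rewrite leNgt; apply/negP => /ltW Cf; apply: nf; exists f.
pose q : R := 3^-1.
have q01 : 0 <= q < 1 by rewrite /q; lra.
have q0 : 0 < q by rewrite /q; lra.
have [f fP] := choice (fun n : nat => large (6 * n%:R * q ^- n)).
have hump (z : nat * V) : exists y, rnorm (y - z.2) <= q ^+ z.1 /\
    2 / 3 * q ^+ z.1 * dual_norm (f z.1) <= rnorm (f z.1 y).
  have [|y] := @dual_norm_hump _ (f z.1) z.2 (q ^+ z.1); last by exists y.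
  by rewrite exprn_ge0// ltW.
have [step stepP] := choice hump.
pose u := fix u n := if n is m.+1 then step (m, u m) else 0.
have uq : geometric_steps 1 q u.
  by move=> n; rewrite mul1r; have [] := stepP (n, u n).
have [l lP] := complete_geometrically_complete q01 uq.
have [M MP] := Fpt l.
have big n : n%:R <= M.
  have [Fn fn] := fP n; apply: le_trans (MP _ Fn).
  have [_ /= hn] := stepP (n, u n).
  have := ler_rnorm_dist (f n l) (f n (step (n, u n))) 0.
  rewrite !subr0 -linearB.
  have := dual_norm_bound (f n) (step (n, u n) - l).
  have := lP n.+1; rewrite rnormB /= exprS.
  have qn0 : 0 < q ^+ n by rewrite exprn_gt0.
  set s := step _ in hn *; set D := dual_norm _ in fn hn *.
  rewrite -(ler_pM2r qn0) mulfVK ?gt_eqF// in fn.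
  set Q := q ^+ n in fn hn qn0 *.
  (* The bounds on the moves after step n add up to half of the bound on
     the n-th one. *)
  have -> : 1 / (1 - q) * (q * Q) = Q / 2 by rewrite /q; field.
  move=> sl /le_trans => /(_ _ (ler_wpM2l (dual_norm_ge0 _) sl)).
  by rewrite -/D => fsl dist; lra.
have := big (Num.truncn M).+1; rewrite leNgt => /negP; apply.
exact: truncnS_gt.
Qed.

End uniform_boundedness.

(** * Norming subspaces and lower bounds *)

Section linear_maps.
Context {R : realType} {k : scalar_kind}.
Local Notation K := (scalars R k).

(** Both norming conditions have this form, with T the restriction map from Z
    to X* or the evaluation map from X to Z*. *)
Lemma equivalent_dual_normP (U : normedModType K) (V : normedModType K)
    (T : {linear U -> dual V}) :
  (forall u, dual_norm (T u) <= rnorm u) ->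
  equivalent_norm (fun u => dual_norm (T u)) <->
  exists2 c, 0 < c & forall u, c * rnorm u <= dual_norm (T u).
Proof.
move=> T1; split=> [[_ [c [C [c0 _ cT]]]]|[c c0 cT]].
  by exists c => // u; case: (cT u).
split; first split.
- by move=> x y; rewrite linearD ler_dual_normD.
- by move=> a x; rewrite linearZ dual_normZ.
- move=> x Tx; apply: rnorm_le0.
  by rewrite -(ler_pM2l c0) mulr0 -Tx.
by exists c, 1; split=> // u; rewrite mul1r.
Qed.

Section restriction.
Context {V : normedModType K} (W : submodClosed V).

Lemma restriction_dual_pred (f : dual V) :
  (fun w : subspace_of W => f (sub_vec w)) \in dual_pred (subspace_of W).
Proof.
apply: (@bounded_dual_pred _ _ _ _ (dual_norm f)) => [a x y|x].
  exact: (dual_linear f).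
exact: dual_norm_bound.
Qed.

Definition restriction (f : dual V) : dual (subspace_of W) :=
  Dual (restriction_dual_pred f).

Lemma restriction_linear : linear restriction.
Proof. by move=> a f g; apply/val_inj. Qed.

HB.instance Definition _ :=
  GRing.isLinear.Build K (dual V) (dual (subspace_of W)) *:%R restriction
    restriction_linear.

Lemma dual_norm_restrictionE (f : dual V) :
  dual_norm (restriction f) =
  sup [set rnorm (f w) | w in [set` W] `&` unit_ball V].
Proof.
congr sup; apply/seteqP; split=> [_ [w w1 <-]|_ [w [Ww w1] <-]].
  by exists (sub_vec w) => //; split=> //; exact: valP w.
by exists (SubspaceOf Ww).
Qed.

Lemma dual_norm_restriction_le (f : dual V) :
  dual_norm (restriction f) <= dual_norm f.
Proof.
by apply: dual_norm_le => w w1; exact: (@dual_norm_ub _ _ _ f (sub_vec w)).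
Qed.

Lemma restriction_bound (f : dual V) w : w \in W ->
  rnorm (f w) <= dual_norm (restriction f) * rnorm w.
Proof.
by move=> Ww; exact: (dual_norm_bound (restriction f) (SubspaceOf Ww)).
Qed.

End restriction.

End linear_maps.

Section norming_bounds.
Context {R : realType} {k : scalar_kind} {E : normedModType (scalars R k)}.
Local Notation K := (scalars R k).
Variables (X : submodClosed E) (Z : submodClosed (dual E)).

Lemma norming_for_dualP : norming_for_dual X Z <->
  exists2 c, 0 < c & forall f, f \in Z ->
    c * dual_norm f <= dual_norm (restriction X f).
Proof.
pose T (f : subspace_of Z) := restriction X (sub_vec f).
have linT : linear T by move=> a f g; rewrite /T -linearP.
pose TL : {linear subspace_of Z -> dual (subspace_of X)} :=
  HB.pack T (GRing.isLinear.Build _ _ _ _ _ linT).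
have TE : (fun f : subspace_of Z =>
    sup [set rnorm (sub_vec f x) | x in [set` X] `&` unit_ball E]) =
    (fun f => dual_norm (TL f)).
  by apply/funext => f; rewrite dual_norm_restrictionE.
have nE (f : subspace_of Z) : rnorm f = dual_norm (sub_vec f) := rnorm_dualE _.
rewrite /norming_for_dual TE equivalent_dual_normP; last first.
  by move=> f; rewrite nE; exact: dual_norm_restriction_le.
split=> -[c c0 cP]; exists c => // f; last first.
  by rewrite nE; apply: cP; exact: valP f.
by move=> Zf; have := cP (SubspaceOf Zf); rewrite nE.
Qed.

Lemma norming_for_subP : norming_for_sub Z X <->
  exists2 c, 0 < c & forall x, x \in X ->
    c * rnorm x <= dual_norm (restriction Z (canonical_map x)).
Proof.
pose T (x : subspace_of X) := restriction Z (canonical_map (sub_vec x)).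
have linT : linear T.
  by move=> a x y; apply/val_inj/funext => f; exact: (dual_linear (sub_vec f)).
pose TL : {linear subspace_of X -> dual (subspace_of Z)} :=
  HB.pack T (GRing.isLinear.Build _ _ _ _ _ linT).
have TE : (fun x : subspace_of X => sup [set rnorm ((f : dual E) (sub_vec x)) |
    f in [set` Z] `&` unit_ball (dual E)]) = (fun x => dual_norm (TL x)).
  by apply/funext => x; rewrite dual_norm_restrictionE.
rewrite /norming_for_sub TE equivalent_dual_normP; last first.
  move=> x; rewrite (le_trans (dual_norm_restriction_le _ _))//.
  apply: dual_norm_le => f f1; rewrite (le_trans (dual_norm_bound f _))//.
  by rewrite ler_piMl ?rnorm_ge0// -rnorm_dualE.
split=> -[c c0 cP]; exists c => // x; last by apply: cP; exact: valP x.
by move=> Xx; exact: (cP (SubspaceOf Xx)).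
Qed.

End norming_bounds.

(** * A seminorm measuring approximation by images *)

Section distance_seminorm.
Context {R : realType} {k : scalar_kind} {U G : normedModType (scalars R k)}.
Local Notation K := (scalars R k).
Variables (T : {linear U -> G}) (Z : submodClosed U) (s : R).
Hypothesis s0 : 0 <= s.

(** The K-functional of the image of Z: how well g is approximated by images
    of elements of Z, with a price s on their norms. At s = 0 it is the
    distance from g to the image. *)
Definition distance_seminorm (g : G) : R :=
  inf [set s * rnorm f + rnorm (g - T f) | f in [set` Z]].

Let has_inf_values g :
  has_inf [set s * rnorm f + rnorm (g - T f) | f in [set` Z]].
Proof.
split.
  by exists (s * rnorm (0 : U) + rnorm (g - T 0)), 0 => //; exact: rpred0.
by exists 0 => _ [f _ <-]; rewrite addr_ge0 ?mulr_ge0 ?rnorm_ge0.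
Qed.

Lemma distance_seminorm_le g f : f \in Z ->
  distance_seminorm g <= s * rnorm f + rnorm (g - T f).
Proof. by move=> Zf; apply: ge_inf; [case: (has_inf_values g)|exists f]. Qed.

Lemma distance_seminorm_approx g e : 0 < e -> exists2 f, f \in Z &
  s * rnorm f + rnorm (g - T f) <= distance_seminorm g + e.
Proof.
move=> e0; have [_ [f Zf <-] /ltW fe] := inf_adherent e0 (has_inf_values g).
by exists f.
Qed.

Lemma distance_seminorm_le_rnorm g : distance_seminorm g <= rnorm g.
Proof.
have := @distance_seminorm_le g 0 (rpred0 _).
by rewrite linear0 subr0 rnorm0 mulr0 add0r.
Qed.

Lemma distance_seminorm_le_image f : f \in Z ->
  distance_seminorm (T f) <= s * rnorm f.
Proof.
by move=> Zf; have := distance_seminorm_le (T f) Zf; rewrite subrr rnorm0 addr0.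
Qed.

Lemma distance_seminormD g h :
  distance_seminorm (g + h) <= distance_seminorm g + distance_seminorm h.
Proof.
apply/ler_addgt0Pr => e e0; have e2 : 0 < e / 2 by rewrite divr_gt0.
have [a Za ga] := distance_seminorm_approx g e2.
have [b Zb hb] := distance_seminorm_approx h e2.
rewrite (le_trans (distance_seminorm_le _ (rpredD Za Zb)))//.
rewrite linearD opprD addrACA.
have := ler_rnormD (g - T a) (h - T b).
have := ler_wpM2l s0 (ler_rnormD a b).
lra.
Qed.

Lemma distance_seminormZ (a : K) g :
  distance_seminorm (a *: g) = rnorm (a : K^o) * distance_seminorm g.
Proof.
have half b h :
    distance_seminorm (b *: h) <= rnorm (b : K^o) * distance_seminorm h.
  apply/ler_addgt0Pr => e e0.
  have b1 : 0 < rnorm (b : K^o) + 1 by rewrite ltr_wpDl ?rnorm_ge0.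
  have [f Zf hf] := distance_seminorm_approx h (divr_gt0 e0 b1).
  rewrite (le_trans (distance_seminorm_le _ (rpredZ b Zf)))//.
  rewrite linearZ -scalerBr !rnormZ -/(rnorm (b : K^o)) mulrCA -mulrDr.
  rewrite (le_trans (ler_wpM2l (rnorm_ge0 _) hf))// mulrDr lerD2l.
  by rewrite mulrCA ler_piMr ?(ltW e0)// ler_pdivrMr// mul1r lerDl.
have [->|a0] := eqVneq a 0.
  rewrite scale0r rnorm0 mul0r; apply/eqP; rewrite eq_le.
  have := distance_seminorm_le_rnorm 0; rewrite rnorm0 => -> /=.
  by apply: lb_le_inf => [|_ [f _ <-]]; [case: (has_inf_values 0)|
    rewrite addr_ge0 ?mulr_ge0 ?rnorm_ge0].
apply/eqP; rewrite eq_le half/=.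
have aV : rnorm (a : K^o) * rnorm (a^-1 : K^o) = 1.
  rewrite -(@rnormZ _ _ K^o a a^-1) -[a *: _]/(a * a^-1) divff//.
  by rewrite -of_real1 rnorm_of_real normr1.
rewrite -{1}[g](scalerK a0) -[leRHS]mul1r -aV -mulrA.
by rewrite ler_wpM2l ?half// rnorm_ge0.
Qed.

End distance_seminorm.

Section reflexive_range.
Context {R : realType} {k : scalar_kind}.
Context {U Y : normedModType (scalars R k)}.
Variables (T : {linear U -> dual Y}) (Z : submodClosed U).
Hypothesis Y_reflexive : reflexive_space Y.

(** In the dual of a reflexive space the functional provided by Hahn-Banach is
    evaluation at a point. *)
Lemma reflexive_hahn_banach (p : dual Y -> R) (M : R) (g : dual Y) :
  (forall f h, p (f + h) <= p f + p h) ->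
  (forall (a : scalars R k) f,
     p (a *: f) = rnorm (a : (scalars R k)^o) * p f) ->
  (forall f, p f <= M * dual_norm f) ->
  exists y, p g <= rnorm (g y) /\ forall f : dual Y, rnorm (f y) <= p f.
Proof.
move=> pD pZ pM; have [Phi [Plin gP Pp]] := hahn_banach_seminorm pD pZ g.
have PhiM (f : dual Y) : rnorm (Phi f) <= M * rnorm f.
  by rewrite rnorm_dualE (le_trans (Pp f)).
have : [set: dual (dual Y)] (Dual (bounded_dual_pred Plin PhiM)) by [].
rewrite -Y_reflexive => -[y _ yP]; exists y.
have yE (f : dual Y) : f y = Phi f by rewrite -[f y]/(canonical_map y f) yP.
by rewrite yE; split=> // f; rewrite yE.
Qed.

(** Replaces the separation of g from the closure of the image of a ball of Z.
    For s = 0 the point y annihilates the image of Z; for s > 0 it lies in s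
    times the polar of the image of the unit ball. *)
Lemma reflexive_range_approx (s : R) (g : dual Y) : 0 <= s ->
  exists y, (forall f, f \in Z -> rnorm (T f y) <= s * rnorm f) /\
    forall e, 0 < e -> exists2 f, f \in Z &
      s * rnorm f + rnorm (g - T f) <= rnorm (g y) + e.
Proof.
move=> s0; have [|y [gy yp]] := @reflexive_hahn_banach (distance_seminorm T Z s)
    1 g (distance_seminormD T Z s0) (distance_seminormZ T Z s0).
  by move=> f; rewrite mul1r -rnorm_dualE distance_seminorm_le_rnorm.
exists y; split=> [f Zf|e e0].
  by rewrite (le_trans (yp _))// distance_seminorm_le_image.
have [f Zf fe] := distance_seminorm_approx T Z s0 g e0.
by exists f => //; rewrite (le_trans fe)// lerD2r.
Qed.

End reflexive_range.

Section lifting.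
Context {R : realType} {k : scalar_kind} {U G : normedModType (scalars R k)}.
Variables (T : {linear U -> G}) (Z : submodClosed U) (C : R).

Lemma closed_geometric_limit (A : set U) (B q : R) (u : nat -> U) l :
  closed A -> 0 <= q < 1 -> (forall n, A (u n)) ->
  (forall n, rnorm (l - u n) <= B * q ^+ n) -> A l.
Proof.
move=> Acl q01 Au ul; apply: Acl => O /nbhs_ballP[e e0 eO].
have re0 : 0 < real_part e.
  by rewrite -(ltr_of_real (k := k)) real_partK ?ltW// of_real0.
have [N NP] := geometric_le B q01 (divr_gt0 re0 (ltr0n R 2)).
exists (u N); split=> //; apply: eO.
rewrite -ball_normE /= -rnormE -(real_partK (ltW e0)) ltr_of_real.
by apply: le_lt_trans (ul N) _; apply: le_lt_trans (NP N (leqnn N)) _; lra.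
Qed.

(** The iteration of the open mapping theorem: the error left after each step
    is lifted in turn, and the corrections decrease geometrically. *)
Lemma lifting_of_approx :
  geometrically_complete U -> closed [set` Z] -> 0 <= C ->
  (forall f, rnorm (T f) <= rnorm f) ->
  (forall g, 0 < rnorm g -> exists f, [/\ f \in Z, rnorm f <= C * rnorm g &
     rnorm (g - T f) <= rnorm g / 2]) ->
  forall g, exists f, [/\ f \in Z, T f = g & rnorm f <= 2 * C * rnorm g].
Proof.
move=> Ucomp Zcl C0 T1 approx_pos g.
have approx h : exists f, [/\ f \in Z, rnorm f <= C * rnorm h &
    rnorm (h - T f) <= rnorm h / 2].
  have [->|/rnorm_gt0/approx_pos//] := eqVneq h 0.
  exists 0; rewrite linear0 subr0 !rnorm0 mulr0 mul0r.
  by split=> //; exact: rpred0.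
have [S SP] := choice approx.
pose rest := fix r n := if n is m.+1 then r m - T (S (r m)) else g.
pose u := fix u n := if n is m.+1 then u m + S (rest m) else 0.
have uT n : g - T (u n) = rest n.
  elim: n => [|n ih] /=; first by rewrite linear0 subr0.
  by rewrite linearD opprD addrA ih.
have Zu n : u n \in Z.
  elim: n => [|n ih] /=; first exact: rpred0.
  by rewrite rpredD//; case: (SP (rest n)).
have restq n : rnorm (rest n) <= rnorm g * 2^-1 ^+ n.
  elim: n => [|n ih]; first by rewrite mulr1.
  have [_ _ Sr] := SP (rest n); rewrite (le_trans Sr)// exprSr mulrA.
  by rewrite ler_wpM2r// invr_ge0.
have q01 : 0 <= (2^-1 : R) < 1 by lra.
have uq : geometric_steps (C * rnorm g) 2^-1 u.
  move=> n /=; rewrite addrAC subrr add0r; have [_ Sr _] := SP (rest n).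
  by rewrite (le_trans Sr)// -mulrA ler_wpM2l.
have [l lP] := Ucomp _ _ _ q01 uq.
have cE : C * rnorm g / (1 - 2^-1) = 2 * C * rnorm g by field.
rewrite cE in lP; exists l; split.
- exact: (closed_geometric_limit Zcl q01 Zu lP).
- apply/eqP; rewrite -subr_eq0; apply/eqP/rnorm_le0.
  apply: (@geometric_le0 _ (2 * C * rnorm g + rnorm g) _ _ q01) => n.
  rewrite (le_trans (ler_rnorm_dist (T (u n)) _ _))// -linearB mulrDl lerD//.
    exact: le_trans (T1 _) (lP n).
  by rewrite rnormB uT.
- by have := lP 0; rewrite subr0 expr0 mulr1.
Qed.

End lifting.

(** * Restriction as an isomorphism of Z onto the dual of X *)

Section restriction_isomorphism.
Context {R : realType} {k : scalar_kind} {E : normedModType (scalars R k)}.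
Local Notation K := (scalars R k).
Variables (X : submodClosed E) (Z : submodClosed (dual E)).

(** The property to which all four conditions reduce: the first clause is
    injectivity of the restriction map on Z, the second one is surjectivity
    with a bounded inverse. *)
Definition restriction_isomorphic := total_over_dual X Z /\
  exists2 C, 0 < C & forall g, exists f,
    [/\ f \in Z, restriction X f = g & dual_norm f <= C * dual_norm g].

Lemma total_over_subP : total_over_sub Z X <->
  forall x, x \in X -> (forall f, f \in Z -> f x = 0) -> x = 0.
Proof.
split=> [tot x Xx xZ|tot].
  by have : ([set` X] `&` preannihilator Z) x by []; rewrite tot.
apply/seteqP; split=> [x [Xx xZ]|_ ->]; first exact: tot.
by split=> [|f _]; [exact: rpred0|rewrite linear0].
Qed.

Lemma total_over_dualP : total_over_dual X Z <->
  forall f, f \in Z -> restriction X f = 0 -> f = 0.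
Proof.
split=> [tot f Zf rf|tot].
  have : (annihilator X `&` [set` Z]) f; last by rewrite tot.
  by split=> // x Xx; exact: (congr1 (fun g : dual _ => g (SubspaceOf Xx)) rf).
apply/seteqP; split=> [f [fX Zf]|_ ->]; last by split=> //; exact: rpred0.
by apply: tot => //; apply/val_inj/funext => x; apply: fX; exact: valP x.
Qed.

Lemma norming_for_dual_total : norming_for_dual X Z -> total_over_dual X Z.
Proof.
move=> /norming_for_dualP[c c0 cP]; apply/total_over_dualP => f Zf rf.
apply: rnorm_le0; rewrite rnorm_dualE.
by rewrite -(ler_pM2l c0) mulr0 (le_trans (cP f Zf))// rf dual_norm0.
Qed.

Lemma norming_for_sub_total : norming_for_sub Z X -> total_over_sub Z X.
Proof.
move=> /norming_for_subP[c c0 cP]; apply/total_over_subP => x Xx xZ.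
apply: rnorm_le0.
rewrite -(ler_pM2l c0) mulr0 (le_trans (cP x Xx))//.
have -> : restriction Z (canonical_map x) = 0.
  by apply/val_inj/funext => f; apply: xZ; exact: valP f.
by rewrite dual_norm0.
Qed.

Hypothesis Z_closed : closed [set` Z].
Hypothesis X_reflexive : reflexive_space (subspace_of X).

Lemma approx_isomorphic (C : R) : 0 < C -> total_over_dual X Z ->
  (forall g : dual (subspace_of X), 0 < rnorm g -> exists f,
    [/\ f \in Z, rnorm f <= C * rnorm g &
        rnorm (g - restriction X f) <= rnorm g / 2]) ->
  restriction_isomorphic.
Proof.
move=> C0 totX approx; split=> //; exists (2 * C); first by rewrite mulr_gt0.
have restriction_le (f : dual E) : rnorm (restriction X f) <= rnorm f.
  by rewrite !rnorm_dualE dual_norm_restriction_le.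
move=> g; have [f [Zf fg fC]] := lifting_of_approx
  (@dual_geometrically_complete _ _ E) Z_closed (ltW C0) restriction_le
  approx g.
by exists f; split=> //; rewrite -!rnorm_dualE.
Qed.

(** Totality of Z over X makes the restrictions dense in X*. If the restriction
    of f is within |g|/2 of g, the lower bound c gives |f| <= (3/2) |g| / c. *)
Lemma norming_for_dual_isomorphic :
  norming_for_dual X Z -> total_over_sub Z X -> restriction_isomorphic.
Proof.
move=> nX /total_over_subP totZ; have totX := norming_for_dual_total nX.
move: nX => /norming_for_dualP[c c0 cP].
apply: (@approx_isomorphic (2 / c)) => // [|g g0]; first by rewrite divr_gt0.
have [y [yZ yg]] :=
  reflexive_range_approx (restriction X) Z X_reflexive g (lexx 0).
have y0 : y = 0.
  apply/val_inj; apply: totZ; first exact: valP y.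
  move=> f Zf; apply: (@rnorm_le0 _ _ K^o).
  by rewrite -(mul0r (rnorm f)); exact: yZ.
have [f Zf] := yg _ (divr_gt0 g0 (ltr0n R 2)).
rewrite y0 linear0 rnorm0 mul0r !add0r => fg; exists f; split=> //.
rewrite mulrAC ler_pdivlMr// mulrC rnorm_dualE (le_trans (cP f Zf))//.
have := ler_rnormD (restriction X f - g) g; rewrite subrK rnorm_dualE rnormB.
lra.
Qed.

(** A point x with |f(x)| <= s |f| on Z has c |x| <= s, so s = c / 4 gives
    |g(x)| <= |g|/4. With another |g|/4 for the approximation of the infimum,
    some f in Z has (c/4) |f| + |g - f|X| <= |g|/2. *)
Lemma norming_for_sub_isomorphic :
  norming_for_sub Z X -> total_over_dual X Z -> restriction_isomorphic.
Proof.
move=> /norming_for_subP[c c0 cP] totX.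
apply: (@approx_isomorphic (2 / c)) => // [|g g0]; first by rewrite divr_gt0.
have s0 : 0 <= c / 4 by lra.
have [y [yZ yg]] := reflexive_range_approx (restriction X) Z X_reflexive g s0.
have y1 : rnorm y <= 1 / 4.
  rewrite -(ler_pM2l c0) (le_trans (cP _ (valP y)))//.
  apply: dual_norm_le => f f1; apply: le_trans (yZ _ (valP f)) _.
  by rewrite mul1r ler_piMr.
have e0 : 0 < rnorm g / 4 by rewrite divr_gt0.
have [f Zf fg] := yg _ e0.
have gy : rnorm (g y) <= rnorm g / 4.
  rewrite (le_trans (dual_norm_bound _ _))// -rnorm_dualE.
  by rewrite ler_wpM2l ?rnorm_ge0//; lra.
have dge0 := rnorm_ge0 (g - restriction X f).
have cf0 : 0 <= c / 4 * rnorm f by rewrite mulr_ge0 ?rnorm_ge0.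
exists f; split=> //; last by lra.
by rewrite mulrAC ler_pdivlMr//; lra.
Qed.

Lemma total_restriction_inj f h : total_over_dual X Z ->
  f \in Z -> h \in Z -> restriction X f = restriction X h -> f = h.
Proof.
move=> /total_over_dualP totX Zf Zh fh.
apply/eqP; rewrite -subr_eq0; apply/eqP; apply: totX.
  by rewrite -scaleN1r rpredD// rpredZ.
by rewrite linearB /= fh subrr.
Qed.

Lemma isomorphic_norming_for_dual :
  restriction_isomorphic -> norming_for_dual X Z.
Proof.
move=> [totX [C C0 lift]]; apply/norming_for_dualP.
exists C^-1; first by rewrite invr_gt0.
move=> f Zf; have [h [Zh hf hC]] := lift (restriction X f).
have -> : f = h by exact: total_restriction_inj.
by rewrite mulrC ler_pdivrMr// mulrC hf.
Qed.

(** A functional on X norming x extends to an element of Z of norm at most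
    C. *)
Lemma isomorphic_norming_for_sub :
  restriction_isomorphic -> norming_for_sub Z X.
Proof.
move=> [totX [C C0 lift]]; apply/norming_for_subP.
exists C^-1; first by rewrite invr_gt0.
move=> x Xx; pose y : subspace_of X := SubspaceOf Xx.
have [Phi [Plin xP PhiP]] := hahn_banach_seminorm
  (@ler_rnormD _ _ (subspace_of X)) (@rnormZ _ _ (subspace_of X)) y.
have PhiM z : rnorm (Phi z) <= 1 * rnorm z by rewrite mul1r.
pose g := Dual (bounded_dual_pred Plin PhiM).
have g1 : dual_norm g <= 1.
  by apply: dual_norm_le => z z1; rewrite (le_trans (PhiP z)).
have [f [Zf fg fC]] := lift g.
have fx : rnorm x <= rnorm (f x).
  by rewrite (le_trans xP)// -[Phi y]/(g y) -fg.
rewrite mulrC ler_pdivrMr// (le_trans fx)//.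
rewrite (le_trans (restriction_bound (canonical_map x) Zf))//.
rewrite ler_wpM2l ?dual_norm_ge0// rnorm_dualE (le_trans fC)// ler_piMr//.
exact: ltW.
Qed.

(** With L the inverse of restriction, g |-> (L g) e is a bounded functional
    on X*, hence evaluation at some x of X; then f e = f x for every f in
    Z. *)
Lemma isomorphic_direct_sum : restriction_isomorphic ->
  direct_sum_decomposition [set` X] (preannihilator Z).
Proof.
move=> iso; split.
  exact/norming_for_sub_total/isomorphic_norming_for_sub.
move: iso => [totX [C C0 lift]]; have [L LP] := choice lift.
have Lr (f : dual E) : f \in Z -> L (restriction X f) = f.
  move=> Zf; have [Zh hf _] := LP (restriction X f).
  exact: total_restriction_inj.
apply/seteqP; split=> // e _.
have Philin : scalar (fun g => L g e : K^o).
  move=> a g h; have [Zg gE _] := LP g; have [Zh hE _] := LP h.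
  by rewrite -{1}gE -{1}hE -linearP Lr ?rpredD ?rpredZ.
have PhiM g : rnorm (L g e : K^o) <= C * rnorm e * rnorm g.
  rewrite (le_trans (dual_norm_bound _ _))// mulrAC ler_wpM2r ?rnorm_ge0//.
  by rewrite rnorm_dualE; case: (LP g).
have : [set: dual (dual (subspace_of X))]
  (Dual (bounded_dual_pred Philin PhiM)) by [].
rewrite -X_reflexive => -[x _ xE].
exists (sub_vec x); first exact: valP x.
exists (e - sub_vec x); last by rewrite addrC subrK.
move=> f Zf; have fx : f (sub_vec x) = f e.
  by rewrite -[LHS]/(canonical_map x (restriction X f)) xE /= Lr.
by rewrite linearB /= fx subrr.
Qed.

Lemma weak_star_closed_annihilator (A : set E) :
  weak_star_closed [set f : dual E | forall x, A x -> f x = 0].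
Proof.
have -> : [set f : dual E | forall x, A x -> f x = 0] =
    \bigcap_(x in A) ((fun f : weak_star E => f x : K^o) @^-1` [set 0]).
  by apply/seteqP; split=> f fA x Ax; exact: fA.
apply: closed_bigI => x _.
have eval_continuous : continuous (fun f : weak_star E => f x : K^o).
  move=> f; have /cvg_sup/(_ x) f_init : nbhs f --> (f : weak_star E) by [].
  apply: cvg_trans (@initial_continuous _ _ (fun g : dual E => g x : K^o) f).
  exact: cvg_app f_init.
apply: closed_comp; first by move=> f _; exact: eval_continuous.
exact/accessible_closed_set1/hausdorff_accessible/norm_hausdorff.
Qed.

(** A functional vanishing on the preannihilator of Z agrees with an element of
    Z on X, hence on the whole sum. *)
Lemma isomorphic_weak_star_closed :
  restriction_isomorphic -> weak_star_closed [set` Z].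
Proof.
move=> iso; have [_ sumE] := isomorphic_direct_sum iso.
have -> : [set` Z] = [set f : dual E | forall x, preannihilator Z x -> f x = 0].
  apply/seteqP; split=> [f Zf x|f fZ]; first exact.
  move: iso => [totX [C C0 lift]]; have [h [Zh hf _]] := lift (restriction X f).
  rewrite /= (_ : f = h)//; apply/val_inj/funext => e.
  have : [set: E] e by []; rewrite -sumE => -[x Xx [z Zz <-]].
  rewrite /= !linearD /= (fZ z Zz) (Zz h Zh) !addr0.
  exact: (congr1 (fun g : dual _ => g (SubspaceOf Xx)) (esym hf)).
exact: weak_star_closed_annihilator.
Qed.

End restriction_isomorphism.

(** On x + z, with z in the preannihilator of Z, a functional f of Z takes the
    value f x, which is at most |x| if |f|X| <= 1. Uniform boundedness thus
    replaces the continuity of the projection onto X. *)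
Lemma direct_sum_norming_for_dual (R : realType) (k : scalar_kind)
    (E : completeNormedModType (scalars R k))
    (X : submodClosed E) (Z : submodClosed (dual E)) :
  [set x + y | x in [set` X] & y in preannihilator Z] = [set: E] ->
  norming_for_dual X Z.
Proof.
move=> sumE.
have [e|C CP] := @uniform_boundedness _ _ E
    [set f | f \in Z /\ dual_norm (restriction X f) <= 1].
  have : [set: E] e by []; rewrite -sumE => -[x Xx [z Zz <-]].
  exists (rnorm x) => f [Zf f1]; rewrite linearD /= (Zz f Zf) addr0.
  by rewrite (le_trans (restriction_bound f Xx))// ler_piMl ?rnorm_ge0.
have C1 : 0 < `|C| + 1 by rewrite ltr_wpDl.
apply/norming_for_dualP; exists (`|C| + 1)^-1; first by rewrite invr_gt0.
move=> f Zf; rewrite mulrC ler_pdivrMr// mulrC.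
have unit_case (t : R) : 0 < t -> dual_norm (restriction X f) <= t ->
    dual_norm f <= (`|C| + 1) * t.
  move=> t0 ft; have tV : real_part `|of_real k t^-1| = t^-1.
    rewrite -/(rnorm (_ : (scalars R k)^o)) rnorm_of_real.
    by rewrite gtr0_norm// invr_gt0.
  have : dual_norm (of_real k t^-1 *: f) <= C.
    apply: CP; split; first exact: rpredZ.
    by rewrite linearZ dual_normZ tV mulrC ler_pdivrMr// mul1r.
  rewrite dual_normZ tV mulrC ler_pdivrMr// => /le_trans; apply.
  by rewrite ler_pM2r// (le_trans (ler_norm _))// lerDl.
(* The restriction of f could vanish, so it is normalized by a slightly larger
   positive number. *)
apply/ler_addgt0Pr => e e0.
have := @unit_case (dual_norm (restriction X f) + e / (`|C| + 1)).
rewrite mulrDr mulrCA divff ?gt_eqF// mulr1; apply.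
  by rewrite ltr_wpDl ?dual_norm_ge0// divr_gt0.
by rewrite lerDl ltW// divr_gt0.
Qed.

Theorem corollary4 (R : realType) (k : scalar_kind)
    (E : completeNormedModType (scalars R k))
    (X : submodClosed E) (Z : submodClosed (dual E))
    (X_closed : closed [set` X]) (Z_closed : closed [set` Z])
    (X_reflexive : reflexive_space (subspace_of X)) :
  [<-> norming_for_dual X Z /\ total_over_sub Z X;
       norming_for_sub Z X /\ total_over_dual X Z;
       norming_for_dual X Z /\ norming_for_sub Z X;
       weak_star_closed [set` Z] /\
         direct_sum_decomposition [set` X] (preannihilator Z)].
Proof.
tfae.
- move=> [nX tZ].
  have iso := norming_for_dual_isomorphic Z_closed X_reflexive nX tZ.
  split; first exact: isomorphic_norming_for_sub.
  exact: norming_for_dual_total.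
- move=> [nZ tX]; split=> //; apply: isomorphic_norming_for_dual.
  exact: norming_for_sub_isomorphic.
- move=> [nX nZ].
  have iso := norming_for_dual_isomorphic Z_closed X_reflexive nX
    (norming_for_sub_total nZ).
  split; first exact: (isomorphic_weak_star_closed X_reflexive iso).
  exact: (isomorphic_direct_sum X_reflexive iso).
- by move=> [_ [tZ sumE]]; split=> //; exact: direct_sum_norming_for_dual.
Qed.
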